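(* Consider the control system $\dot x=f(x)+g(x)u$ with $f,g$ locally Lipschitz, $x\in\mathbb{R}^n$, $u\in U\subset\mathbb{R}^m$. Let $h:\mathbb{R}^n\to\mathbb{R}$ be continuously differentiable, let $\mathcal{C}\subset\mathbb{R}^n$ be a set such that $\mathcal{C}=\{x:h(x)\ge0\}$, $\partial\mathcal{C}=\{x:h(x)=0\}$, $\mathrm{Int}(\mathcal{C})=\{x:h(x)>0\}$, and let $B$ be an associated reciprocal control barrier function for the system, with class $\mathcal{K}$ functions $\alpha_1,\alpha_2,\alpha_3$. Then any locally Lipschitz continuous controller $u:\mathrm{Int}(\mathcal{C})\to U$ such that $u(x)\in K_{\mathrm{rcbf}}(x)$ for all $x\in\mathrm{Int}(\mathcal{C})$, where $$K_{\mathrm{rcbf}}(x)=\{u\in U: L_fB(x)+L_gB(x)u-\alpha_3(h(x))\le0\},$$ renders the set $\mathrm{Int}(\mathcal{C})$ forward invariant.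
   Context: $\mathrm{Int}(\mathcal{C})$, $\partial\mathcal{C}$ denote interior and boundary. $L_fB(x)=\frac{\partial B}{\partial x}(x)f(x)$, $L_gB(x)=\frac{\partial B}{\partial x}(x)g(x)$. Class $\mathcal{K}$: continuous strictly increasing functions $\beta:[0,a)\to[0,\infty)$, $a>0$ (possibly $\infty$), with $\beta(0)=0$; arguments are understood to lie in the domain. Reciprocal control barrier function (RCBF): a continuously differentiable $B:\mathrm{Int}(\mathcal{C})\to\mathbb{R}$ for which there are class $\mathcal{K}$ functions $\alpha_1,\alpha_2,\alpha_3$ such that for all $x\in\mathrm{Int}(\mathcal{C})$, $$\frac1{\alpha_1(h(x))}\le B(x)\le\frac1{\alpha_2(h(x))},\qquad \inf_{u\in U}[L_fB(x)+L_gB(x)u-\alpha_3(h(x))]\le0.$$ A controller $u(\cdot)$ renders a set $\mathcal{S}$ forward invariant if, for the closed-loop system $\dot x=f(x)+g(x)u(x)$, every solution with $x(t_0)=x_0\in\mathcal{S}$ satisfies $x(t)\in\mathcal{S}$ for all $t\in I_u(x_0)$, where $I_u(x_0)=[t_0,\tau_{\max})$ is the maximal time interval of existence of the closed-loop solution (forward completeness is not claimed). *)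

(* Defs.v *)
From HB Require Import structures.
From mathcomp Require Import all_boot all_order all_algebra.
From mathcomp Require Import all_classical all_reals all_analysis.

Set Implicit Arguments.
Unset Strict Implicit.
Unset Printing Implicit Defensive.

Import Order.TTheory GRing.Theory Num.Theory.
Import numFieldNormedType.Exports.

Local Open Scope classical_set_scope.
Local Open Scope ring_scope.

Definition boundary (T : topologicalType) (A : set T) : set T :=
  closure A `\` A°.

(** In the library's notion a Lipschitz constant exists near each pair of points
    of [A]: near a diagonal pair this is the usual local Lipschitz condition,
    which implies the one near the other pairs (local boundedness). *)
Definition locally_lipschitz_on (R : realType) (V W : normedModType R)
    (A : set V) (phi : V -> W) : Prop :=
  [locally [lipschitz phi x | x in A]].

(** The row vector of partial derivatives. *)
Definition gradient (R : realType) (n : nat) (phi : 'cV[R]_n -> R)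
    (x : 'cV[R]_n) : 'rV[R]_n :=
  \row_i 'D_(delta_mx i 0) phi x.

(** [phi] is total; only its values on the set [A], meant to be open,
    matter. *)
Definition continuously_differentiable_on (R : realType) (n : nat)
    (A : set 'cV[R]_n) (phi : 'cV[R]_n -> R) : Prop :=
  (forall x, A x -> differentiable phi x) /\
  (forall x, A x -> {for x, continuous (gradient phi)}).

(** The domain is the half-open interval from [0] to [a] excluded, for [a]
    possibly infinite; the values of the underlying total function elsewhere
    are irrelevant. *)
Definition class_K_dom (R : realType) (a : \bar R) : set R :=
  [set r | 0 <= r /\ (r%:E < a)%E].

Record class_K (R : realType) := ClassK {
  class_K_bound : \bar R ;
  class_K_fun :> R -> R ;
  class_K_bound_gt0 : (0 < class_K_bound)%E ;
  class_K_ge0 : forall r, class_K_dom class_K_bound r -> 0 <= class_K_fun r ;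
  class_K_0 : class_K_fun 0 = 0 ;
  class_K_continuous :
    {within class_K_dom class_K_bound, continuous class_K_fun} ;
  class_K_increasing : forall r s,
    class_K_dom class_K_bound r -> class_K_dom class_K_bound s ->
    r < s -> class_K_fun r < class_K_fun s
}.

Section ControlSystem.
Context (R : realType) (n m : nat).
Variables (f : 'cV[R]_n -> 'cV[R]_n) (g : 'cV[R]_n -> 'M[R]_(n, m)).
Variable U : set 'cV[R]_m.

Definition Lie_f (B : 'cV[R]_n -> R) (x : 'cV[R]_n) : R :=
  (gradient B x *m f x) 0 0.

Definition Lie_g (B : 'cV[R]_n -> R) (x : 'cV[R]_n) : 'rV[R]_m :=
  gradient B x *m g x.

Definition rcbf_expr (h B : 'cV[R]_n -> R) (alpha3 : class_K R)
    (x : 'cV[R]_n) (v : 'cV[R]_m) : R :=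
  Lie_f B x + (Lie_g B x *m v) 0 0 - alpha3 (h x).

(** The infimum is taken in the extended reals: it is [+oo] if [U] is empty
    and may be [-oo]. *)
Definition is_rcbf (C : set 'cV[R]_n) (h B : 'cV[R]_n -> R)
    (alpha1 alpha2 alpha3 : class_K R) : Prop :=
  continuously_differentiable_on C° B /\
  forall x, C° x ->
    [/\ class_K_dom (class_K_bound alpha1) (h x),
        class_K_dom (class_K_bound alpha2) (h x) &
        class_K_dom (class_K_bound alpha3) (h x)] /\
    [/\ (alpha1 (h x))^-1 <= B x,
        B x <= (alpha2 (h x))^-1 &
        (ereal_inf [set (rcbf_expr h B alpha3 x v)%:E | v in U] <= 0)%E].

Definition K_rcbf (h B : 'cV[R]_n -> R) (alpha3 : class_K R)
    (x : 'cV[R]_n) : set 'cV[R]_m :=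
  [set v | U v /\ rcbf_expr h B alpha3 x v <= 0].

Definition closed_loop (u : 'cV[R]_n -> 'cV[R]_m) (x : 'cV[R]_n) : 'cV[R]_n :=
  f x + g x *m u x.

(** Here the controller [u] is only meaningful on [D]. If a solution had to
    stay in [D] by definition, the invariance of [D] would be void; so a
    solution is a continuous curve in the whole state space, bound to the
    differential equation at all times at which it lies in [D]. In particular a
    curve which follows the equation in [D] and reaches the boundary of [D] at
    a finite time is a solution, whatever [u] does there. If [D] is open and
    the closed-loop field is continuous on it, the right derivative at the
    initial time [t0] follows from the equation at later times. *)
Definition is_solution (D : set 'cV[R]_n) (u : 'cV[R]_n -> 'cV[R]_m)
    (t0 : R) (tau : \bar R) (x : R -> 'cV[R]_n) : Prop :=
  [/\ (t0%:E < tau)%E,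
      {within [set t | t0 <= t /\ (t%:E < tau)%E], continuous x} &
      forall t, t0 < t -> (t%:E < tau)%E -> D (x t) ->
        is_derive t 1 x (closed_loop u (x t))].

Definition is_maximal_solution (D : set 'cV[R]_n) (u : 'cV[R]_n -> 'cV[R]_m)
    (t0 : R) (tau : \bar R) (x : R -> 'cV[R]_n) : Prop :=
  is_solution D u t0 tau x /\
  forall tau' x', is_solution D u t0 tau' x' -> (tau <= tau')%E ->
    (forall t, t0 <= t -> (t%:E < tau)%E -> x' t = x t) -> tau' = tau.

Definition renders_forward_invariant (D : set 'cV[R]_n)
    (u : 'cV[R]_n -> 'cV[R]_m) (S : set 'cV[R]_n) : Prop :=
  forall (t0 : R) (tau : \bar R) (x : R -> 'cV[R]_n),
    is_maximal_solution D u t0 tau x -> S (x t0) ->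
    forall t, t0 <= t -> (t%:E < tau)%E -> S (x t).

End ControlSystem.

(* Main.v *)
(** If a solution left [Int C], there would be a first time [T] with [h (x T) <= 0].
    Close to [T] from the left, [h (x t)] lies below a fixed value [h (x s0)], so
    the derivative of [B (x t)] is at most [alpha3 (h (x t)) <= alpha3 (h (x s0))]
    and [B (x t)] stays bounded on a left neighbourhood of [T]. But
    [B (x t) >= 1 / alpha1 (h (x t))] tends to infinity at [T]. *)
Require Import Defs.
From mathcomp Require Import all_boot all_order all_algebra.
From mathcomp Require Import all_classical all_reals all_analysis.
From mathcomp Require Import lra.

Set Implicit Arguments.
Unset Strict Implicit.
Unset Printing Implicit Defensive.

Import Order.TTheory GRing.Theory Num.Theory.
Import numFieldNormedType.Exports.

Local Open Scope classical_set_scope.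
Local Open Scope ring_scope.

(** Chain rule: the differential of [phi] is linear, so expanding [v] in the standard basis turns
    its value at [v] into the sum of partial derivatives times coordinates. *)
Lemma is_derive_gradient (R : realType) (n : nat) (phi : 'cV[R]_n -> R)
    (x : R -> 'cV[R]_n) (t : R) (v : 'cV[R]_n) :
  differentiable phi (x t) -> is_derive t 1 x v ->
  is_derive t 1 (phi \o x) ((gradient phi (x t) *m v) 0 0).
Proof.
move=> dphi [/derivable1_diffP dx xv].
have dphix : differentiable (phi \o x) t by exact: differentiable_comp.
apply: DeriveDef; first exact/derivable1_diffP.
rewrite deriveE// diff_comp//= -(deriveE _ dx) xv [in LHS](matrix_sum_delta v).
rewrite linear_sum mxE; apply: eq_bigr => i _.
by rewrite big_ord1 linearZ/= mxE deriveE// mulrC.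
Qed.

(** [T] is the infimum of the times in [[a, b]] at which [phi <= 0]. The last clause records
    [phi T <= 0] through left neighbourhoods of [T], the form in which it is used twice later. *)
Lemma first_exit (R : realType) (a b : R) (phi : R -> R) :
  a <= b -> {within `[a, b], continuous phi} -> 0 < phi a -> phi b <= 0 ->
  exists T, [/\ a < T <= b, forall t, a <= t < T -> 0 < phi t &
    forall e, 0 < e -> exists2 s, a < s < T & forall t, s <= t < T -> phi t < e].
Proof.
move=> ab /subspace_continuousP cphi phia phib.
pose A := [set t | a <= t <= b /\ phi t <= 0].
have Ab : A b by split; rewrite ?ab ?lexx.
have Aa : lbound A a by move=> t [/andP[]].
have infA : has_inf A by split; [exists b | exists a].
have aT : a <= inf A by apply: lb_le_inf => //; exists b.
have Tb : inf A <= b by apply: ge_inf => //; exists a.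
have cT : phi t @[t --> within `[a, b] (nbhs (inf A))] --> phi (inf A).
  by apply: cphi; rewrite /= in_itv/= aT.
(* Were [phi] positive at the infimum, it would be so on a ball around it, yet that ball contains
   points of [A]. *)
have phiT : phi (inf A) <= 0.
  rewrite leNgt; apply/negP => phiT0.
  have /nbhs_ballP[e /= e0 eP] : \forall t \near inf A, t \in `[a, b] -> 0 < phi t.
    exact: (cvgr_gt _ cT).
  have [t At te] := inf_adherent e0 infA.
  have Tt : inf A <= t by apply: ge_inf => //; exists a.
  have [tab] := At; rewrite leNgt => /negP; apply; apply: eP.
    by rewrite /ball/= distrC ger0_norm ?subr_ge0// ltrBlDl.
  by rewrite /= in_itv.
have aT' : a < inf A.
  rewrite lt_neqAle aT andbT; apply: contraTneq phia => ->.
  by rewrite -leNgt.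
exists (inf A); split.
- by rewrite aT'.
- move=> t /andP[at_ tT]; rewrite ltNge; apply/negP => phit.
  suff : inf A <= t by rewrite leNgt tT.
  apply: ge_inf; first by exists a.
  by split=> //; rewrite at_ (le_trans (ltW tT)).
move=> e e0.
have /nbhs_ballP[d /= d0 dP] : \forall t \near inf A, t \in `[a, b] -> phi t < e.
  by apply: (cvgr_lt _ cT); exact: le_lt_trans phiT e0.
(* The midpoint keeps [s] above [a]; the other term keeps [[s, inf A)] inside the ball of radius
   [d]. *)
pose s := Num.max ((a + inf A) / 2) (inf A - d / 2).
have sT : s < inf A by rewrite gt_max midf_lt//= ltrBlDr ltrDl divr_gt0.
have as_ : a < s by rewrite lt_max midf_lt.
exists s; first by rewrite as_.
move=> t /andP[st tT]; apply: dP.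
  rewrite /ball/= ger0_norm ?subr_ge0 ?(ltW tT)//.
  have : inf A - d / 2 <= t by apply: le_trans st; rewrite le_max lexx orbT.
  lra.
by rewrite /= in_itv/= (le_trans (ltW as_))//= (le_trans (ltW tT)).
Qed.

Lemma class_K_gt0 (R : realType) (alpha : class_K R) (r : R) :
  class_K_dom (class_K_bound alpha) r -> 0 < r -> 0 < alpha r.
Proof.
move=> dr r0; rewrite -(class_K_0 alpha); apply: class_K_increasing => //.
by split=> //; exact: class_K_bound_gt0.
Qed.

(** Continuity at [0], where the value is [0]. Applied to [alpha1], it makes the lower bound of [B]
    blow up as [h] tends to [0]. *)
Lemma class_K_small (R : realType) (alpha : class_K R) (e : R) : 0 < e ->
  exists2 d, 0 < d & forall r, class_K_dom (class_K_bound alpha) r ->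
    r < d -> alpha r < e.
Proof.
move=> e0; have /subspace_continuousP c := @class_K_continuous _ alpha.
have d0 : class_K_dom (class_K_bound alpha) 0.
  by split=> //; exact: class_K_bound_gt0.
have /nbhs_ballP[d /= d_gt0 dP] : \forall r \near (0 : R),
    class_K_dom (class_K_bound alpha) r -> alpha r < e.
  by apply: (cvgr_lt _ (c _ d0)); rewrite /from_subspace class_K_0.
exists d => // r dr rd; apply: dP => //.
by rewrite /ball/= sub0r normrN ger0_norm//; case: dr.
Qed.

Theorem corollary1 (R : realType) (n m : nat)
    (f : 'cV[R]_n -> 'cV[R]_n) (g : 'cV[R]_n -> 'M[R]_(n, m))
    (U : set 'cV[R]_m) (h : 'cV[R]_n -> R) (C : set 'cV[R]_n)
    (B : 'cV[R]_n -> R) (alpha1 alpha2 alpha3 : class_K R) :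
  locally_lipschitz_on setT f ->
  locally_lipschitz_on setT g ->
  continuously_differentiable_on setT h ->
  C = [set x | 0 <= h x] ->
  boundary C = [set x | h x = 0] ->
  C° = [set x | 0 < h x] ->
  is_rcbf f g U C h B alpha1 alpha2 alpha3 ->
  forall u : 'cV[R]_n -> 'cV[R]_m,
    locally_lipschitz_on C° u ->
    (forall x, C° x -> U (u x)) ->
    (forall x, C° x -> K_rcbf f g U h B alpha3 x (u x)) ->
    renders_forward_invariant f g C° u C°.
Proof.
move=> _ _ [dh _] _ _ CE [[dB _] BP] u _ _ uK t0 tau x [[_ cx xP] _] Sx0 t1.
move=> t01 t1tau; apply: contrapT.
rewrite CE/= in Sx0 dB BP uK xP * => /negP; rewrite -leNgt => xt1.
have cphi : {within `[t0, t1], continuous (h \o x)}.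
  apply: within_continuous_comp.
    by move=> y _; exact/differentiable_continuous/dh.
  apply: continuous_subspaceW cx => t /=; rewrite in_itv/= => /andP[-> tt1].
  by split=> //; apply: le_lt_trans t1tau; rewrite lee_fin.
have [T [/andP[t0T Tt1] hpos hsmall]] := first_exit t01 cphi Sx0 xt1.
(* The domain of [alpha3] may be bounded, so the level compared with [h (x t)] is itself a value of
   [h] on the curve before [T], hence in that domain. *)
pose s0 := (t0 + T) / 2.
have s0P : t0 < s0 < T by rewrite !midf_lt.
have hs0 : 0 < h (x s0) by apply: hpos; case/andP: s0P => /ltW -> ->.
have [s1 /andP[t0s1 s1T] hs1] := hsmall _ hs0.
pose M := alpha3 (h (x s0)).
(* [M] will bound the derivative of [B] along the curve on [[s1, T)], so [K] bounds [B] there by the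
   mean value theorem. *)
pose K := B (x s1) + M * (T - s1).
have derB t : s1 <= t < T ->
    is_derive t 1 (B \o x) ((gradient B (x t) *m closed_loop f g u (x t)) 0 0).
  move=> /andP[s1t tT]; have t0t := lt_le_trans t0s1 s1t.
  have ht : 0 < h (x t) by apply: hpos; rewrite (ltW t0t).
  apply: is_derive_gradient; first exact: dB.
  apply: xP => //; apply: le_lt_trans t1tau.
  by rewrite lee_fin (le_trans (ltW tT)).
have dom3 t : t0 < t < T -> class_K_dom (class_K_bound alpha3) (h (x t)).
  case/andP=> t0t tT; have [] // := BP (x t).
    by apply: hpos; rewrite (ltW t0t).
  by case.
(* The controller condition bounds the derivative by [alpha3 (h (x t))]; monotonicity and
   [h (x t) < h (x s0)] give [M]. *)
have dBM t : s1 <= t < T ->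
    (gradient B (x t) *m closed_loop f g u (x t)) 0 0 <= M.
  move=> /[dup] tP /andP[s1t tT]; have t0t := lt_le_trans t0s1 s1t.
  have ht : 0 < h (x t) by apply: hpos; rewrite (ltW t0t).
  have [_] := uK _ ht; rewrite /rcbf_expr /Lie_f /Lie_g subr_le0 => Lh.
  rewrite /closed_loop mulmxDr mxE mulmxA (le_trans Lh)//.
  apply: ltW; apply: class_K_increasing; last exact: hs1.
  - by apply: dom3; rewrite t0t.
  - exact: dom3.
have M0 : 0 < M by apply: class_K_gt0 => //; exact: dom3.
have BK t : s1 < t < T -> B (x t) <= K.
  case/andP=> s1t tT.
  have inT s : s \in `[s1, t] -> s1 <= s < T.
    by rewrite in_itv/= => /andP[-> /le_lt_trans ->].
  have [||c /subset_itv_oo_cc cst E] := MVT (f := B \o x)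
    (df := fun t => (gradient B (x t) *m closed_loop f g u (x t)) 0 0) s1t.
  - by move=> s /subset_itv_oo_cc /inT; exact: derB.
  - by apply: derivable_within_continuous => s /inT sP; have [] := derB s sP.
  rewrite /K -lerBlDl E (@le_trans _ _ (M * (t - s1)))//.
    by rewrite ler_wpM2r ?subr_ge0 ?(ltW s1t)//; exact/dBM/inT.
  by rewrite ler_pM2l// lerD2r ltW.
have B0 t : t0 <= t < T -> 0 < h (x t) /\
    class_K_dom (class_K_bound alpha1) (h (x t)) /\
    (alpha1 (h (x t)))^-1 <= B (x t).
  move=> tP; have ht := hpos _ tP.
  by have [[? _ _] [? _ _]] := BP _ ht.
(* Positivity of [K] makes [K^-1] an admissible threshold for [alpha1]; it holds since [B (x s1)] is
   at least the inverse of a positive number. *)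
have K0 : 0 < K.
  have [|h1 [d1]] := B0 s1; first by rewrite ltW.
  move/(lt_le_trans _)=> B1; rewrite /K addr_gt0 ?mulr_gt0 ?subr_gt0//.
  by apply: B1; rewrite invr_gt0 class_K_gt0.
have [|d d0 dP] := @class_K_small _ alpha1 K^-1; first by rewrite invr_gt0.
have [s2 /andP[t0s2 s2T] hs2] := hsmall _ d0.
(* Past [s1] the bound [B (x t) <= K] holds; past [s2], [alpha1 (h (x t)) < K^-1]. Inverting the
   latter contradicts the former. *)
pose t := (Num.max s1 s2 + T) / 2.
have sT : Num.max s1 s2 < T by rewrite gt_max s1T.
have tT : t < T by rewrite midf_lt.
have [s1t s2t] : s1 < t /\ s2 < t.
  by apply/andP; rewrite -gt_max midf_lt.
have [|ht [dt Bt]] := B0 t; first by rewrite tT (ltW (lt_trans t0s1 _)).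
have := dP _ dt (hs2 _ _); rewrite (ltW s2t) tT => /(_ isT).
apply/negP; rewrite -leNgt -[leRHS]invrK lef_pV2 ?posrE ?invr_gt0 ?class_K_gt0//.
by rewrite (le_trans Bt)// BK// s1t.
Qed.
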